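(* Let $G$ be a chordal graph with family of overspan graphs $\mathcal A=\mathcal A(G)$ (defined in the context). For every $\mathcal B\subseteq\mathcal A$, $\nu(G_{\mathcal B})=\tau(G_{\mathcal B})$.
   Context: A tree representation of a graph $G$ is a tree $T_0$ with a family $\mathcal F=\{F_v: v\in V(G)\}$ of subtrees of $T_0$ such that for distinct $u,v$, $uv\in E(G)$ iff $F_u$ and $F_v$ share a vertex. Fix one with $|V(T_0)|$ minimum. Choose an independent set $I$ of $G$ maximal with the property that for each $v\in I$, $F_v$ is a path all of whose vertices have degree at most $2$ in $T_0$; moreover $I$ is chosen so that for every $v\in I$, $F_v$ contains no member of $\mathcal F$ as a proper subgraph. For $v\in I$, $F_v$ is an $I$-path (trivial if it is a single vertex, which is then its endvertex). Colour each edge of $T_0$ red if it lies in some $I$-path and black otherwise. The base tree $T$ is obtained from $T_0$ by suppressing, one by one, every degree-$2$ vertex that is not an endvertex of any $I$-path; edges of $T$ inherit the colours. For an edge $e=rs$ of $T$, the overspan graph $A_e$ has vertex set $V(G)\setminus I$; it has a loop at $v$ if $F_v$ contains both $r$ and $s$, and an edge between distinct $u,v$ if $uv\in E(G)$ and ($r\in V(F_u)$, $s\in V(F_v)$ or vice versa). The family $\mathcal A(G)$ contains one graph $A_e$ for each red edge $e$ of $T$ and two copies of $A_e$ for each black edge $e$ of $T$. For $\mathcal B\subseteq\mathcal A$, $G_{\mathcal B}$ is the graph on $V(G)\setminus I$ whose edge set (including loops) is the union of the edge sets of members of $\mathcal B$. $\nu(H)$ is the maximum size of a matching of $H$, where a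 matching may contain loops provided all its edges are pairwise vertex-disjoint; $\tau(H)$ is the minimum size of a vertex set meeting every edge of $H$ (so every vertex carrying a loop must be in it). *)

(* Defs.v *)
From mathcomp Require Import all_boot.
Set Implicit Arguments.
Unset Strict Implicit.
Unset Printing Implicit Defensive.

Section SimpleGraphs.

Variables (V : finType) (G : rel V).

Definition simple_graph : Prop := symmetric G /\ irreflexive G.

Definition chordal : Prop :=
  forall c : seq V, ucycle G c -> 3 < size c ->
    exists x y, [/\ x \in c, y \in c, G x y, y != next c x & y != prev c x].

Definition degree (x : V) : nat := #|[set y | G x y]|.

Definition independent (J : {set V}) : Prop := {in J &, forall u v, ~~ G u v}.

(* The subgraph of G induced by A is connected, resp. acyclic.  A ucycle of
   size 2 is a single edge traversed back and forth, hence the bound. *)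
Definition connected_on (A : {set V}) : Prop :=
  {in A &, forall x y, connect [rel a b | [&& a \in A, b \in A & G a b]] x y}.

Definition acyclic_on (A : {set V}) : Prop :=
  forall c : seq V, {subset c <= A} -> ucycle G c -> size c <= 2.

Definition tree_on (A : {set V}) : Prop :=
  [/\ A != set0, connected_on A & acyclic_on A].

(* When G is a tree, so that A induces exactly the edges between consecutive
   vertices of the sequence: A is a path having x as an endvertex.  The only
   vertex of a trivial path is its endvertex. *)
Definition endvertex (A : {set V}) (x : V) : Prop :=
  exists p, [/\ path G x p, uniq (x :: p) & A = [set y in x :: p]].

Definition is_path (A : {set V}) : Prop := exists x, endvertex A x.

End SimpleGraphs.

(* A subtree of a tree is an induced subgraph, so it is given by its vertex
   set. *)
Definition tree_representation (V : finType) (G : rel V) (T0 : finType)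
    (t0 : rel T0) (F : V -> {set T0}) : Prop :=
  [/\ simple_graph t0, tree_on t0 [set: T0], forall v, tree_on t0 (F v)
    & forall u v, u != v -> G u v = (F u :&: F v != set0)].

Definition min_tree_representation (V : finType) (G : rel V) (T0 : finType)
    (t0 : rel T0) (F : V -> {set T0}) : Prop :=
  tree_representation G t0 F /\
  forall (T1 : finType) (t1 : rel T1) (F1 : V -> {set T1}),
    tree_representation G t1 F1 -> #|T0| <= #|T1|.

(* Undirected graphs with loops allowed: symmetric relations H, with a loop at
   x when H x x; the corresponding edge is then [set x; x] = [set x]. *)
Section LoopGraphs.

Variables (W : finType) (H : rel W).

Definition edges : {set {set W}} :=
  [set e : {set W} | [exists x, exists y, H x y && (e == [set x; y])]].

Definition matching (M : {set {set W}}) : bool :=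
  (M \subset edges) && trivIset M.

Definition vertex_cover (C : {set W}) : bool :=
  [forall e in edges, e :&: C != set0].

Definition nu : nat := \max_(M : {set {set W}} | matching M) #|M|.

Definition tau : nat := #|[arg min_(C < [set: W] | vertex_cover C) #|C|]|.

End LoopGraphs.

(* cred is the relation of the red edges; the other edges are black. *)
Record cgraph (T : finType) := CGraph {
  cverts : {set T};
  cadj : rel T;
  cred : rel T
}.

(* Suppression of a vertex w of degree 2: w is deleted and its two neighbours
   are joined.  The new edge is red when the two edges it replaces are red; for
   the vertices suppressed below these two edges have the same colour, as an
   I-path through one of them has w as an inner vertex. *)
Definition suppress (T : finType) (K : cgraph T) (w : T) : cgraph T :=
  CGraph
    (cverts K :\ w)
    [rel x y | [&& x != w, y != w, x != y
                 & cadj K x y || (cadj K x w && cadj K w y)]]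
    [rel x y | [&& x != w, y != w, x != y
                 & cred K x y || (cred K x w && cred K w y)]].

Section Overspan.

Variables (V : finType) (G : rel V).
Variables (T0 : finType) (t0 : rel T0) (F : V -> {set T0}).

Definition path_independent (J : {set V}) : Prop :=
  independent G J /\
  {in J, forall v, is_path t0 (F v) /\ {in F v, forall x, degree t0 x <= 2}}.

Definition valid_I (I : {set V}) : Prop :=
  [/\ path_independent I,
      forall J : {set V}, path_independent J -> I \subset J -> J = I
    & {in I, forall v u, ~~ (F u \proper F v)}].

Variable I : {set V}.

Definition red_edge : rel T0 :=
  [rel x y | t0 x y && [exists v in I, (x \in F v) && (y \in F v)]].

Definition suppressible (w : T0) : Prop :=
  degree t0 w = 2 /\ ~ (exists2 v, v \in I & endvertex t0 (F v) w).

Definition suppression_order (s : seq T0) : Prop :=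
  uniq s /\ forall w, w \in s <-> suppressible w.

Definition base_tree (s : seq T0) : cgraph T0 :=
  foldl (@suppress T0) (CGraph [set: T0] t0 red_edge) s.

Definition overspan (e : {set T0}) : rel {v : V | v \notin I} :=
  [rel u v | [exists r, exists s, (e == [set r; s]) &&
     (if u == v then (r \in F (val u)) && (s \in F (val u))
      else G (val u) (val v) &&
           ((r \in F (val u)) && (s \in F (val v))
            || (s \in F (val u)) && (r \in F (val v))))]].

(* The family A(G), as an index set: (e, b) stands for a copy of overspan e,
   the second copy (e, true) being present for black edges only. *)
Definition overspan_family (K : cgraph T0) : {set {set T0} * bool} :=
  [set i | (i.1 \in edges (cadj K)) && (i.2 ==> (i.1 \notin edges (cred K)))].

Definition union_graph (B : {set {set T0} * bool}) : rel {v : V | v \notin I} :=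
  [rel u v | [exists i in B, overspan i.1 u v]].

End Overspan.

Arguments overspan [V] G [T0] F I e.
Arguments union_graph [V] G [T0] F I B.

(* Main.v *)
Require Import Defs.
From mathcomp Require Import all_boot.

(** Put the vertices carrying a loop of [G_B] aside. The trace on the base tree
    [T] of any other subtree [F v] is connected and contains no edge of [B], so
    a 2-colouring of [V(T)] that changes exactly along the edges of [B] is
    constant on it, while every edge of [G_B] between two such vertices changes
    the colour. Hence [G_B] without its looped vertices is bipartite, and
    Koenig's theorem applies. *)

Set Implicit Arguments.
Unset Strict Implicit.
Unset Printing Implicit Defensive.

(** * Koenig's theorem *)

Section SetFamilies.

Variable W : finType.
Implicit Types (E M : {set {set W}}) (C S e : {set W}) (f : pred W).

Definition hitting_set E C : bool := [forall e in E, e :&: C != set0].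

Definition covering_number E : nat :=
  #|[arg min_(C < [set: W] | hitting_set E C) #|C|]|.

Definition packing_number E : nat :=
  \max_(M : {set {set W}} | (M \subset E) && trivIset M) #|M|.

Lemma hitting_setP E C :
  reflect {in E, forall e, exists2 x, x \in e & x \in C} (hitting_set E C).
Proof.
apply: (iffP forall_inP) => hitC e eE; have := hitC e eE.
  by case/set0Pn=> x /setIP[xe xC]; exists x.
by case=> x xe xC; apply/set0Pn; exists x; rewrite inE xe.
Qed.

Lemma hitting_set_sub E M C :
  M \subset E -> hitting_set E C -> hitting_set M C.
Proof.
by move=> /subsetP sME /hitting_setP hitC; apply/hitting_setP=> e /sME /hitC.
Qed.

Lemma hitting_setT E : set0 \notin E -> hitting_set E [set: W].
Proof.
move=> E0; apply/forall_inP=> e eE; rewrite setIT.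
by apply: contraNneq E0 => <-.
Qed.

Lemma covering_number_attained E :
  set0 \notin E -> exists2 C, hitting_set E C & #|C| = covering_number E.
Proof.
rewrite /covering_number => /hitting_setT hitT.
by case: arg_minnP => // C hitC _; exists C.
Qed.

Lemma covering_number_min E C : hitting_set E C -> covering_number E <= #|C|.
Proof.
rewrite /covering_number => hitC; case: arg_minnP => [|C' _]; last exact.
by apply/hitting_setP=> e /(hitting_setP _ _ hitC)[x xe _]; exists x.
Qed.

Lemma covering_number_sub E M :
  set0 \notin E -> M \subset E -> covering_number M <= covering_number E.
Proof.
move=> /covering_number_attained[C hitC <-] sME.
exact/covering_number_min/(hitting_set_sub sME).
Qed.

Lemma covering_number_trivIset M :
  set0 \notin M -> trivIset M -> covering_number M <= #|M|.
Proof.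
move=> M0 tiM; have partM : partition M (cover M) by apply/and3P.
have trM := transversalP partM; rewrite -(card_transversal trM).
apply/covering_number_min/forall_inP=> e eM; rewrite setIC -cards_eq0.
by case/and3P: trM => _ _ /forall_inP/(_ e eM)/eqP->.
Qed.

Lemma card_trivIset_hitting_set M C :
  trivIset M -> hitting_set M C -> #|M| <= #|C|.
Proof.
move=> tiM /hitting_setP hitC.
apply: leq_trans (_ : #|[set x in cover M | x \in C]| <= _); last first.
  by apply/subset_leq_card/subsetP=> x; rewrite inE => /andP[].
rewrite -!sum1_card big_set big_trivIset_cond //=.
by apply: leq_sum => e /hitC[x xe xC]; rewrite (bigD1 x) ?xe.
Qed.

Lemma packing_number_max E M :
  M \subset E -> trivIset M -> #|M| <= packing_number E.
Proof. by move=> sME tiM; apply: (bigmax_sup M); rewrite ?sME. Qed.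

Lemma packing_number_sub E M :
  M \subset E -> packing_number M <= packing_number E.
Proof.
move=> sME; apply/bigmax_leqP=> N /andP[sNM].
exact/packing_number_max/(subset_trans sNM).
Qed.

Lemma packing_le_covering E :
  set0 \notin E -> packing_number E <= covering_number E.
Proof.
move=> /covering_number_attained[C hitC <-].
apply/bigmax_leqP=> M /andP[sME tiM].
exact: card_trivIset_hitting_set tiM (hitting_set_sub sME hitC).
Qed.

Definition covering_critical M : Prop :=
  {in M, forall e, covering_number (M :\ e) < covering_number M}.

Lemma covering_critical_subfamily E :
  set0 \notin E ->
  exists M, [/\ M \subset E, covering_critical M
                & covering_number M = covering_number E].
Proof.
move=> E0; pose same_covering M := covering_number M == covering_number E.
have [|M /minsetP[/eqP covM minM] sME] := @minset_exists _ same_covering E.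
  exact: eqxx.
exists M; split=> // e eM; have sDM : M :\ e \subset M := subsetDl _ _.
have M0 : set0 \notin M by apply: contra E0; apply: (subsetP sME).
rewrite ltn_neqAle covering_number_sub // andbT.
apply/eqP; rewrite covM => covD; have := minM _ (introT eqP covD) sDM.
by move/setP/(_ e); rewrite !inE eqxx eM.
Qed.

Lemma covering_critical_hitting_set M e :
  set0 \notin M -> covering_critical M -> e \in M ->
  exists S, [/\ hitting_set (M :\ e) S, [disjoint e & S]
                & #|S| < covering_number M].
Proof.
move=> M0 critM eM; have lt_cov := critM e eM.
have [|S hitS cardS] := @covering_number_attained (M :\ e).
  by apply: contra M0; apply/subsetP/subsetDl.
exists S; split=> //; last by rewrite cardS.
rewrite -setI_eq0; apply: contraLR lt_cov => eS; rewrite -leqNgt -cardS.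
apply/covering_number_min/forall_inP=> d dM; have [-> // | ne_de] := eqVneq d e.
by move/forall_inP: hitS; apply; rewrite !inE ne_de.
Qed.

(** A member of a bipartite family has at most one vertex on each side. *)
Definition bipartite_family f E : Prop :=
  {in E, forall e, {in e &, injective f}}.

(** The hitting sets of a bipartite family form a lattice: meet on one side of
    the bipartition, join on the other one. *)
Definition meet_join f (side : bool) S1 S2 : {set W} :=
  [set w | if f w == side then (w \in S1) && (w \in S2)
           else (w \in S1) || (w \in S2)].

Lemma meet_joinC f side S1 S2 :
  meet_join f side S1 S2 = meet_join f side S2 S1.
Proof. by apply/setP=> w; rewrite !inE andbC orbC. Qed.

Lemma card_meet_join f side S1 S2 :
  #|meet_join f side S1 S2| + #|meet_join f (~~ side) S1 S2| = #|S1| + #|S2|.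
Proof.
rewrite -!sum1_card !(big_mkcond (fun w => w \in _)) /= -!big_split.
apply: eq_bigr => w _ /=; rewrite !inE.
by case: (f w); case: side; case: (w \in S1); case: (w \in S2).
Qed.

Lemma meet_join_hits f side e S1 S2 :
  {in e &, injective f} ->
  (exists2 x, x \in e & x \in S1) -> (exists2 x, x \in e & x \in S2) ->
  exists2 x, x \in e & x \in meet_join f side S1 S2.
Proof.
move=> f_inj [a ae aS1] [b be bS2].
have [fa | fa] := eqVneq (f a) side; last first.
  by exists a; rewrite // inE (negPf fa) aS1.
have [fb | fb] := eqVneq (f b) side; last first.
  by exists b; rewrite // inE (negPf fb) bS2 orbT.
have eab : a = b by apply: f_inj; rewrite ?fa ?fb.
by exists a; rewrite // inE aS1 eab bS2 if_same.
Qed.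

Lemma meet_join_hits_off_side f e x S1 S2 :
  {in e &, injective f} -> x \in e -> x \notin S1 ->
  (exists2 y, y \in e & y \in S1) ->
  exists2 y, y \in e & y \in meet_join f (f x) S1 S2.
Proof.
move=> f_inj xe xS1 [y ye yS1]; exists y; rewrite // inE yS1.
by case: eqP => // /(f_inj _ _ ye xe) eyx; rewrite -eyx yS1 in xS1.
Qed.

Lemma hitting_set_exchange f M e1 e2 x S1 S2 :
  bipartite_family f M -> e1 \in M -> e2 \in M -> e1 != e2 ->
  x \in e1 -> x \in e2 -> x \notin S1 -> x \notin S2 ->
  hitting_set (M :\ e1) S1 -> hitting_set (M :\ e2) S2 ->
  hitting_set M (meet_join f (f x) S1 S2) /\
  hitting_set M (x |: meet_join f (~~ f x) S1 S2).
Proof.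
move=> f_inj e1M e2M ne12 xe1 xe2 xS1 xS2 /hitting_setP hit1 /hitting_setP hit2.
have hitS1 e : e \in M -> e != e1 -> exists2 y, y \in e & y \in S1.
  by move=> eM ne; apply: hit1; rewrite !inE ne.
have hitS2 e : e \in M -> e != e2 -> exists2 y, y \in e & y \in S2.
  by move=> eM ne; apply: hit2; rewrite !inE ne.
have ne21 : e2 != e1 by rewrite eq_sym.
have hit_others side e : e \in M -> e != e1 -> e != e2 ->
    exists2 y, y \in e & y \in meet_join f side S1 S2.
  by move=> eM ne1 ne2; apply: meet_join_hits; [exact: f_inj | auto | auto].
split; apply/hitting_setP=> e eM.
- have [-> | ne1] := eqVneq e e1.
    rewrite meet_joinC.
    exact: meet_join_hits_off_side (f_inj _ e1M) xe1 xS2 (hitS2 _ e1M ne12).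
  have [-> | ne2] := eqVneq e e2; last exact: hit_others.
  exact: meet_join_hits_off_side (f_inj _ e2M) xe2 xS1 (hitS1 _ e2M ne21).
- have [-> | ne1] := eqVneq e e1; first by exists x; rewrite ?setU11.
  have [-> | ne2] := eqVneq e e2; first by exists x; rewrite ?setU11.
  have [y ye yS] := hit_others (~~ f x) e eM ne1 ne2.
  by exists y; rewrite // inE yS orbT.
Qed.

(* Were two members to share [x], the hitting sets that criticality provides
   for the removal of either one could be exchanged for two hitting sets of the
   whole family, one of which would be too small. *)
Lemma covering_critical_trivIset f M :
  set0 \notin M -> bipartite_family f M -> covering_critical M -> trivIset M.
Proof.
move=> M0 bipM critM; apply/trivIsetP=> e1 e2 e1M e2M ne12.
rewrite -setI_eq0; apply/negPn/negP=> /set0Pn[x /setIP[xe1 xe2]].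
have [S1 [hit1 dis1 lt1]] := covering_critical_hitting_set M0 critM e1M.
have [S2 [hit2 dis2 lt2]] := covering_critical_hitting_set M0 critM e2M.
have xS1 := negbT (disjointFr dis1 xe1).
have xS2 := negbT (disjointFr dis2 xe2).
have [hitC1 hitC2] :=
  hitting_set_exchange bipM e1M e2M ne12 xe1 xe2 xS1 xS2 hit1 hit2.
have := leq_add (covering_number_min hitC1) (covering_number_min hitC2).
apply/negP; rewrite -ltnNge cardsU1 addnCA card_meet_join.
apply: leq_ltn_trans (leq_add (leq_b1 _) (leqnn _)) _.
by rewrite addnA add1n -addnS leq_add.
Qed.

Theorem koenig f E :
  set0 \notin E -> bipartite_family f E -> packing_number E = covering_number E.
Proof.
move=> E0 bipE; apply/eqP; rewrite eqn_leq packing_le_covering //=.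
have [M [sME critM <-]] := covering_critical_subfamily E0.
have M0 : set0 \notin M by apply: contra E0; apply: (subsetP sME).
have tiM : trivIset M.
  by apply: (@covering_critical_trivIset f) => // e /(subsetP sME)/bipE.
exact: leq_trans (covering_number_trivIset M0 tiM) (packing_number_max sME tiM).
Qed.

End SetFamilies.

Lemma eq_set2 (T : finType) (a b x y : T) :
  ([set a; b] == [set x; y]) = (a == x) && (b == y) || (a == y) && (b == x).
Proof.
apply/eqP/orP=> [eq_ab | [] /andP[/eqP-> /eqP->] //]; last exact: setUC.
have: a \in [set x; y] by rewrite -eq_ab set21.
have: b \in [set x; y] by rewrite -eq_ab set22.
have: x \in [set a; b] by rewrite eq_ab set21.
have: y \in [set a; b] by rewrite eq_ab set22.
rewrite !inE ![_ == a]eq_sym ![_ == b]eq_sym.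
by case: (a == x); case: (a == y); case: (b == x); case: (b == y); auto.
Qed.

Section LoopGraphs.

Variables (W : finType) (H : rel W).

Lemma edgesP (e : {set W}) :
  reflect (exists x y, H x y /\ e = [set x; y]) (e \in edges H).
Proof.
rewrite inE; apply: (iffP existsP) => [[x /existsP[y /andP[Hxy /eqP->]]]|].
  by exists x, y.
by move=> [x [y [Hxy ->]]]; exists x; apply/existsP; exists y; rewrite Hxy eqxx.
Qed.

Lemma edges_set2 x y : symmetric H -> ([set x; y] \in edges H) = H x y.
Proof.
move=> H_sym; apply/edgesP/idP => [[a [b [Hab /eqP]]] | Hxy]; last first.
  by exists x, y.
by rewrite eq_set2 => /orP[] /andP[/eqP-> /eqP->]; rewrite // H_sym.
Qed.

Lemma edges_neq0 : set0 \notin edges H.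
Proof. by apply/edgesP=> -[x [y [_ /setP/(_ x)]]]; rewrite !inE eqxx. Qed.

(* Once the loops are covered, so are the edges having a looped end. *)
Definition core_edges : {set {set W}} :=
  [set e in edges H | (#|e| == 1) || [forall x in e, ~~ H x x]].

Lemma core_edges_sub : core_edges \subset edges H.
Proof. by apply/subsetP=> e; rewrite inE => /andP[]. Qed.

Lemma hitting_core_edges C :
  hitting_set core_edges C -> hitting_set (edges H) C.
Proof.
move=> /hitting_setP hitC; apply/hitting_setP=> e eH.
have [loopless | /forall_inPn[x xe /negPn Hxx]] :=
  boolP [forall x in e, ~~ H x x].
  by apply: hitC; rewrite inE eH loopless orbT.
have [|y /set1P-> xC] := hitC [set x]; last by exists x.
rewrite inE cards1 eqxx andbT; apply/edgesP; exists x, x.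
by rewrite setUid.
Qed.

Definition bipartite_off_loops (f : pred W) : Prop :=
  {in [pred x | ~~ H x x] &, forall x y, H x y -> f x != f y}.

Lemma bipartite_core_edges f :
  bipartite_off_loops f -> bipartite_family f core_edges.
Proof.
move=> bipf e; rewrite inE => /andP[/edgesP[x [y [Hxy ->]]]].
case/orP=> [/cards1P[z ->] a b /set1P-> /set1P-> // | /forall_inP loopless].
have := bipf _ _ (loopless _ (set21 _ _)) (loopless _ (set22 _ _)) Hxy.
by move=> /eqP nexy a b /set2P[]-> /set2P[]-> // eq_f; case: nexy.
Qed.

Theorem nu_eq_tau_off_loops f : bipartite_off_loops f -> nu H = tau H.
Proof.
move=> /bipartite_core_edges bip_core.
suff : packing_number (edges H) = covering_number (edges H) by [].
have E0 := edges_neq0; have core_sub := core_edges_sub.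
have core0 : set0 \notin core_edges.
  by apply: contra E0; apply: (subsetP core_sub).
apply/eqP; rewrite eqn_leq packing_le_covering //=.
apply: leq_trans (packing_number_sub core_sub); rewrite (koenig core0 bip_core).
have [C /hitting_core_edges hitC <-] := covering_number_attained core0.
exact: covering_number_min.
Qed.

End LoopGraphs.

(** * Signings of forests *)

Section Signings.

Variable T : finType.
Implicit Types (e b : rel T) (c : pred T).

(** In the language of signed graphs, [b] tells the negative edges of [e]. *)
Definition potential e b c : Prop := forall x y, e x y -> c x (+) c y = b x y.

Definition balanced e b : Prop := exists c, potential e b c.

Definition all_signings_balanced e : Prop :=
  forall b, symmetric b -> balanced e b.

Definition del_edge e x y : rel T :=
  [rel a d | e a d && ([set a; d] != [set x; y])].

Lemma del_edge_sub e x y : subrel (del_edge e x y) e.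
Proof. by move=> a d /andP[]. Qed.

Lemma del_edge_sym e x y : symmetric e -> symmetric (del_edge e x y).
Proof. by move=> e_sym a d; rewrite /del_edge /= e_sym setUC. Qed.

Lemma acyclic_on_sub e e' (A : {set T}) :
  subrel e' e -> acyclic_on e A -> acyclic_on e' A.
Proof.
move=> sub_e acyc c cA /andP[cyc uniq_c]; apply: acyc cA _.
by rewrite /ucycle uniq_c andbT; apply: sub_cycle cyc.
Qed.

Lemma acyclic_bridge e x y :
  symmetric e -> irreflexive e -> acyclic_on e [set: T] -> e x y ->
  ~~ connect (del_edge e x y) x y.
Proof.
move=> e_sym e_irr acyc exy.
apply/negP=> /connectP[_ /shortenP[p p_path p_uniq _] y_last].
have cyc : ucycle e (x :: p).
  rewrite /ucycle p_uniq andbT /= rcons_path -y_last e_sym exy andbT.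
  by apply: sub_path p_path; apply: del_edge_sub.
have := acyc _ (fun z _ => in_setT z) cyc.
case: p p_path y_last {p_uniq cyc} => [|z [|//]] /= => [_ y_x | xz y_z] _.
  by rewrite y_x e_irr in exy.
by rewrite /del_edge /= y_z eqxx !andbF in xz.
Qed.

(* Switching the colours of the component of [x] repairs the sign of [xy]. *)
Lemma balanced_bridge e b x y :
  symmetric e -> symmetric b -> ~~ connect (del_edge e x y) x y ->
  balanced (del_edge e x y) b -> balanced e b.
Proof.
move=> e_sym b_sym /negPf xyN [c pot_c].
pose comp_x := connect (del_edge e x y) x.
pose switch := c x (+) c y (+) b x y.
exists (fun z => c z (+) (comp_x z && switch)) => a d ead.
have pot_xy : (c x (+) (comp_x x && switch)) (+) (c y (+) (comp_x y && switch))
    = b x y.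
  rewrite /comp_x xyN connect0 /switch.
  by case: (c x); case: (c y); case: (b x y).
have [e_xy | ne_xy] := boolP ([set a; d] == [set x; y]); last first.
  have e'ad : del_edge e x y a d by rewrite /del_edge /= ead.
  have -> : comp_x a = comp_x d.
    apply: (same_connect1r _ e'ad).
    exact/sym_connect_sym/del_edge_sym.
  by rewrite -(pot_c _ _ e'ad) addbACA addbb addbF.
move: e_xy; rewrite eq_set2 => /orP[] /andP[/eqP-> /eqP->]; first exact: pot_xy.
by rewrite addbC b_sym.
Qed.

Lemma card_edges_del_edge e x y :
  symmetric e -> e x y -> #|edges (del_edge e x y)| < #|edges e|.
Proof.
move=> e_sym exy; have del_sym := @del_edge_sym e x y e_sym.
apply/proper_card/properP; split.
  apply/subsetP=> _ /edgesP[a [d [/del_edge_sub ead ->]]].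
  by rewrite edges_set2.
by exists [set x; y]; rewrite edges_set2 // /del_edge /= eqxx andbF.
Qed.

Theorem acyclic_balanced e :
  symmetric e -> irreflexive e -> acyclic_on e [set: T] ->
  all_signings_balanced e.
Proof.
move=> + + + b b_sym; have [n] := ubnP #|edges e|.
elim: n e => // n IHn e le_n e_sym e_irr acyc.
have [no_edge | [_ /edgesP[x [y [exy _]]]]] := set_0Vmem (edges e).
  by exists pred0 => x y; rewrite -(edges_set2 _ _ e_sym) no_edge inE.
apply: (balanced_bridge e_sym b_sym (acyclic_bridge e_sym e_irr acyc exy)).
apply: IHn.
- exact: leq_trans (card_edges_del_edge e_sym exy) le_n.
- exact: del_edge_sym.
- by move=> a; rewrite /del_edge /= e_irr.
- exact: acyclic_on_sub (@del_edge_sub e x y) acyc.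
Qed.

Lemma connected_on_colouring e (A : {set T}) :
  symmetric e ->
  connected_on e A <->
  forall c, {in A &, forall x y, e x y -> c x = c y} ->
            {in A &, forall x y, c x = c y}.
Proof.
move=> e_sym; split=> [connA c const_c x y xA yA | constA x y xA yA].
  apply: (@closed_connect _ _ c) (connA x y xA yA) => a d.
  by case/and3P=> aA dA; apply: const_c.
set eA := (X in connect X); have eA_sym : symmetric eA.
  by move=> a d; rewrite /eA /= e_sym andbCA.
have <- : connect eA x x = connect eA x y; last exact: connect0.
apply: constA xA yA => a d aA dA ead.
by apply: (same_connect1r (sym_connect_sym eA_sym)); rewrite /eA /= aA dA.
Qed.

End Signings.

(** * The base tree *)

Section Suppression.

Variable T : finType.
Implicit Types (K : cgraph T) (A : {set T}) (w : T).

Lemma suppress_sym K w :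
  symmetric (cadj K) -> symmetric (cadj (suppress K w)).
Proof.
move=> K_sym x y.
rewrite /= [cadj K y x]K_sym [cadj K y w]K_sym [cadj K w x]K_sym.
by rewrite andbCA [y == x]eq_sym [cadj K x w && _]andbC.
Qed.

Lemma neighbours_degree_le2 (e : rel T) w x y a :
  degree e w <= 2 -> e w x -> e w y -> e w a -> x != y -> (x == a) || (y == a).
Proof.
move=> dw wx wy wa nxy; apply: contraLR dw.
rewrite negb_or -ltnNge => /andP[nxa nya].
have <- : #|[set a; x; y]| = 3.
  by rewrite -setUA cardsU1 cards2 nxy !inE negb_or ![a == _]eq_sym nxa nya.
by apply/subset_leq_card/subsetP=> z; rewrite !inE => /orP[/orP[]|] /eqP->.
Qed.

Lemma degree_suppress K w x :
  symmetric (cadj K) -> degree (cadj K) w <= 2 ->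
  degree (cadj (suppress K w)) x <= degree (cadj K) x.
Proof.
move=> K_sym dw; have [xw | xNw] := boolP (cadj K x w); last first.
  apply/subset_leq_card/subsetP=> y; rewrite !inE /= (negPf xNw) orbF.
  by case/and4P.
pose N z := [set y | cadj K z y].
have sN : [set y | cadj (suppress K w) x y] \subset (N x :\ w) :|: (N w :\ x).
  apply/subsetP=> y; rewrite !inE => /and4P[_ -> nxy].
  by rewrite eq_sym nxy /= => /orP[-> | /andP[_ ->]] //; rewrite orbT.
apply: leq_trans (subset_leq_card sN) _.
apply: leq_trans (leq_card_setU _ _).1 _.
have xNw : x \in N w by rewrite inE K_sym.
have wNx : w \in N x by rewrite inE.
rewrite /degree -/(N x) (cardsD1 w (N x)) wNx addnC leq_add2r -ltnS.
by move: dw; rewrite /degree -/(N w) (cardsD1 x (N w)) xNw.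
Qed.

Lemma suppress_balanced K w :
  symmetric (cadj K) -> degree (cadj K) w <= 2 ->
  all_signings_balanced (cadj K) -> all_signings_balanced (cadj (suppress K w)).
Proof.
move=> K_sym dw balK b b_sym.
pose a := odflt w [pick z | cadj K w z].
(* The edge from [w] to [a] is positive, the other one inherits the sign of the
   edge that replaces both. *)
pose sign_w z := (z != a) && b a z.
pose sign x y :=
  if x == w then sign_w y else if y == w then sign_w x else b x y.
have sign_sym : symmetric sign.
  move=> x y; rewrite /sign.
  have [-> | _] := eqVneq x w; last by rewrite b_sym.
  by have [-> | _] := eqVneq y w.
have [c pot_c] := balK _ sign_sym.
exists c => x y /and4P[/negPf xNw /negPf yNw nxy /orP[/pot_c-> | /andP[xw wy]]].
  by rewrite /sign xNw yNw.
have wx : cadj K w x by rewrite K_sym.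
have wa : cadj K w a by rewrite /a; case: pickP => // /(_ y); rewrite wy.
have -> : c x (+) c y = (c x (+) c w) (+) (c w (+) c y) by rewrite addbA addbK.
rewrite (pot_c _ _ xw) (pot_c _ _ wy) /sign xNw eqxx /sign_w.
have /orP[/eqP exa | /eqP eya] := neighbours_degree_le2 dw wx wy wa nxy.
  by rewrite -exa eqxx eq_sym nxy.
by rewrite -eya eqxx nxy addbF b_sym.
Qed.

Lemma suppress_connected_on K w A :
  symmetric (cadj K) -> connected_on (cadj K) A ->
  connected_on (cadj (suppress K w)) (A :\ w).
Proof.
move=> K_sym /(connected_on_colouring A K_sym) constA.
apply/(connected_on_colouring _ (suppress_sym w K_sym)) => c const_c x y.
rewrite !inE => /andP[nxw xA] /andP[nyw yA].
pose a := odflt w [pick z in A :\ w | cadj K w z].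
have c_nbr z : z \in A -> z != w -> cadj K w z -> c a = c z.
  move=> zA nzw wz; have zAw : z \in A :\ w by rewrite !inE nzw.
  rewrite /a; case: pickP => [d /andP[dAw wd] /= | /(_ z)]; last first.
    by rewrite zAw wz.
  have [-> // | ndz] := eqVneq d z; apply: const_c => //.
  move: dAw; rewrite !inE => /andP[ndw _].
  by rewrite /= ndw nzw ndz [cadj K d w]K_sym wd wz orbT.
pose c' z := if z == w then c a else c z.
have := constA c' _ x y xA yA; rewrite /c' (negPf nxw) (negPf nyw); apply.
move=> p q pA qA pq; case: (eqVneq p w) pq => [-> | npw] pq.
  by case: (eqVneq q w) pq => // nqw; apply: c_nbr.
case: (eqVneq q w) pq => [-> | nqw] pq; first by rewrite (c_nbr p) // K_sym.
have [-> // | npq] := eqVneq p q.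
by apply: const_c; rewrite ?inE ?npw ?nqw //= npw nqw npq pq.
Qed.

(* What survives, of a tree and a family [F] of subtrees, when vertices of
   degree at most 2 are suppressed. *)
Record tree_like (V : Type) (F : V -> {set T}) K : Prop := {
  tree_like_sym : symmetric (cadj K);
  tree_like_verts : forall x y, cadj K x y -> x \in cverts K;
  tree_like_balanced : all_signings_balanced (cadj K);
  tree_like_connected : forall v, connected_on (cadj K) (F v :&: cverts K)
}.

Lemma tree_like_suppress V (F : V -> {set T}) K w :
  degree (cadj K) w <= 2 -> tree_like F K -> tree_like F (suppress K w).
Proof.
move=> dw [K_sym K_verts K_bal K_conn]; split.
- exact: suppress_sym.
- move=> x y /and4P[nxw _ _ xy]; rewrite !inE nxw /=.
  by case/orP: xy => [/K_verts | /andP[/K_verts]].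
- exact: suppress_balanced.
- by move=> v; rewrite setIDA; apply: suppress_connected_on.
Qed.

Lemma tree_like_foldl_suppress V (F : V -> {set T}) (s : seq T) K :
  {in s, forall w, degree (cadj K) w <= 2} -> tree_like F K ->
  tree_like F (foldl (@suppress T) K s).
Proof.
elim: s K => //= w s IHs K deg_s tlK.
have dw : degree (cadj K) w <= 2 by apply: deg_s; rewrite mem_head.
apply: IHs; last exact: tree_like_suppress.
move=> z zs; apply: leq_trans (degree_suppress z (tree_like_sym tlK) dw) _.
by apply: deg_s; rewrite inE zs orbT.
Qed.

End Suppression.

Lemma tree_like_base_tree (V : finType) (G : rel V) (T0 : finType)
    (t0 : rel T0) (F : V -> {set T0}) (I : {set V}) (s : seq T0) :
  tree_representation G t0 F -> suppression_order t0 F I s ->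
  tree_like F (base_tree t0 F I s).
Proof.
move=> [[t_sym t_irr] [_ _ t_acyc] F_tree _] [_ s_supp].
apply: tree_like_foldl_suppress => [w /s_supp[/= -> //]|]; split=> //=.
- exact: acyclic_balanced.
- by move=> v; rewrite setIT; have [_ F_conn _] := F_tree v.
Qed.

(** * Bipartiteness of the union of overspan graphs *)

Section UnionGraph.

Variables (V : finType) (G : rel V) (T0 : finType) (F : V -> {set T0}).
Variables (I : {set V}) (K : cgraph T0) (B : {set {set T0} * bool}).

Hypothesis tlK : tree_like F K.
Hypothesis sBK : {in B, forall i, i.1 \in edges (cadj K)}.

Let GB := union_graph G F I B.

Definition chosen_edge : rel T0 :=
  [rel x y | [exists i in B, i.1 == [set x; y]]].

Lemma chosen_edge_sym : symmetric chosen_edge.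
Proof. by move=> x y; rewrite /chosen_edge /= setUC. Qed.

Lemma chosen_edge_sub : subrel chosen_edge (cadj K).
Proof.
move=> x y /exists_inP[i /sBK iK /eqP ei].
by rewrite ei (edges_set2 _ _ (tree_like_sym tlK)) in iK.
Qed.

Lemma union_graph_loop u x y :
  chosen_edge x y -> x \in F (val u) -> y \in F (val u) -> GB u u.
Proof.
move=> /exists_inP[i iB ei] xF yF; apply/exists_inP; exists i => //=.
apply/existsP; exists x; apply/existsP; exists y.
by rewrite ei eqxx xF yF.
Qed.

Lemma union_graph_neq u v :
  u != v -> GB u v ->
  exists x y, [/\ chosen_edge x y, x \in F (val u) & y \in F (val v)].
Proof.
move=> /negPf nuv /exists_inP[i iB /existsP[x /existsP[y /andP[ei]]]].
have xy : chosen_edge x y by apply/exists_inP; exists i.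
rewrite nuv => /andP[_ /orP[] /andP[uF vF]]; first by exists x, y.
by exists y, x; rewrite chosen_edge_sym.
Qed.

Lemma potential_trace_constant c u :
  potential (cadj K) chosen_edge c -> ~~ GB u u ->
  {in F (val u) :&: cverts K &, forall x y, c x = c y}.
Proof.
move=> pot_c loopless.
have /(connected_on_colouring _ (tree_like_sym tlK)) constF :=
  tree_like_connected tlK (v := val u).
apply: constF => x y /setIP[xF _] /setIP[yF _] xy.
have := pot_c _ _ xy.
have /negPf-> : ~~ chosen_edge x y.
  by apply: contra loopless => /union_graph_loop; apply.
by case: (c x); case: (c y).
Qed.

Lemma union_graph_bipartite_off_loops : exists f, bipartite_off_loops GB f.
Proof.
have [c pot_c] := tree_like_balanced tlK chosen_edge_sym.
pose f (u : {v | v \notin I}) := [exists x in F (val u) :&: cverts K, c x].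
have fE u x : ~~ GB u u -> x \in F (val u) -> x \in cverts K -> f u = c x.
  move=> loopless xF xK; have xFK : x \in F (val u) :&: cverts K by apply/setIP.
  apply/exists_inP/idP => [[y yFK]|]; last by exists x.
  by rewrite (potential_trace_constant pot_c loopless yFK xFK).
exists f => u v /= uN vN uv.
have nuv : u != v by apply: contraNneq uN => euv; rewrite {2}euv.
have [x [y [xy xF yF]]] := union_graph_neq nuv uv.
have Kxy := chosen_edge_sub xy.
have Kyx : cadj K y x by rewrite (tree_like_sym tlK).
rewrite (fE u x) ?(tree_like_verts tlK Kxy) //.
rewrite (fE v y) ?(tree_like_verts tlK Kyx) //.
by have := pot_c _ _ Kxy; rewrite xy; case: (c x); case: (c y).
Qed.

End UnionGraph.

Theorem lemma4p1 (V : finType) (G : rel V) (T0 : finType) (t0 : rel T0)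
    (F : V -> {set T0}) (I : {set V}) (s : seq T0)
    (hG : simple_graph G) (hchordal : chordal G)
    (hrep : min_tree_representation G t0 F)
    (hI : valid_I G t0 F I)
    (hs : suppression_order t0 F I s)
    (B : {set {set T0} * bool})
    (hB : B \subset overspan_family (base_tree t0 F I s)) :
  nu (union_graph G F I B) = tau (union_graph G F I B).
Proof.
have tlT := tree_like_base_tree hrep.1 hs.
have sBT : {in B, forall i, i.1 \in edges (cadj (base_tree t0 F I s))}.
  by move=> i /(subsetP hB); rewrite inE => /andP[].
have [f bip_f] := union_graph_bipartite_off_loops G I tlT sBT.
exact: nu_eq_tau_off_loops bip_f.
Qed.
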